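(* Let $G$ be a finite $2$-group. Then either each cyclic subgroup generated by an element of $G \setminus \Phi(G)$ is a perfect code of $G$ or there exists a generalized quaternion subgroup of $G$ which is a perfect code of $G$.
   Context: For a finite group $G$ with identity $1$ and a subset $S\subseteq G\setminus\{1\}$ with $S^{-1}=S$ (possibly $S=\emptyset$), the Cayley graph $\mathrm{Cay}(G,S)$ has vertex set $G$, with $x,y$ adjacent if and only if $yx^{-1}\in S$. A perfect code in a graph $\Gamma$ with vertex set $V$ is a subset $C\subseteq V$ such that no two vertices of $C$ are adjacent and every vertex in $V\setminus C$ is adjacent to exactly one vertex in $C$. A subset (in particular a subgroup) $C$ of $G$ is called a perfect code of $G$ if there exists such an $S$ for which $C$ is a perfect code in $\mathrm{Cay}(G,S)$. A $2$-group is a group whose order is a power of $2$. $\Phi(G)$ is the Frattini subgroup of $G$, the intersection of all maximal subgroups of $G$. Generalized quaternion $2$-groups are the groups $\langle a,b \mid a^{2^{n-1}}=1,\ b^2=a^{2^{n-2}},\ b^{-1}ab=a^{-1}\rangle$ of order $2^n$ with $n\ge 3$ (the quaternion group of order $8$ is included). ''Either ... or'' is inclusive. *)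

(* Defs.v *)
From mathcomp Require Import all_boot all_fingroup all_solvable.

Set Implicit Arguments.
Unset Strict Implicit.
Unset Printing Implicit Defensive.

Local Open Scope group_scope.

Definition perfect_code (T : finType) (V : {set T}) (e : rel T) (C : {set T}) :
    Prop :=
  [/\ C \subset V,
      {in C &, forall x y, ~~ e x y}
    & {in V :\: C, forall x, #|[set c in C | e x c]| = 1%N}].

Definition connection_set (gT : finGroupType) (G : {group gT})
    (S : {set gT}) : Prop :=
  S \subset G^# /\ S^-1 = S.

(* Adjacency of Cay(G, S); its vertex set is G, not the ambient type gT. *)
Definition cayley_adj (gT : finGroupType) (S : {set gT}) : rel gT :=
  fun x y => y * x^-1 \in S.

Definition group_perfect_code (gT : finGroupType) (G : {group gT})
    (C : {set gT}) : Prop :=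
  exists2 S : {set gT}, connection_set G S & perfect_code G (cayley_adj S) C.

(* 'Q_(2 ^ n) is presented by <x, y | x^(2^(n-1)), y^2 = x^(2^(n-2)),
   x^y = x^-1> only for n > 2 (see Grp_quaternion). *)
Definition generalized_quaternion (gT : finGroupType) (Q : {group gT}) : Prop :=
  exists2 n : nat, (2 < n)%N & Q \isog 'Q_(2 ^ n).

(* Main.v *)
Require Import Defs.
From mathcomp Require Import all_boot all_fingroup all_solvable.

(** The code condition for H in Cay(G, S) says that S lies in G \ H and meets
    every right coset of H other than H exactly once.  So H is a perfect code
    exactly when its nontrivial right cosets have an inverse-closed system of
    representatives.

    For a 2-group H such a system exists as soon as every g in N_G(H) \ H with
    g^2 in H has an element s with s^-1 = s in its coset Hg
    ([group_perfect_code_of_lift]).  Choose the representatives greedily, in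
    pairs {s, s^-1}, and allow a self-inverse s only inside N_G(H); a maximal
    choice is complete.  Indeed, a missed coset in a double coset D = HxH can
    be paired with any other missed coset in D^-1.  Since inversion gives equally
    many representatives in D and in D^-1, the obstruction is that D = D^-1 and
    that Hx is the only missed coset of D.  If x is outside N_G(H), then D
    consists of an even number of right cosets, because that number divides
    |H| and is not 1, while the representatives in D pair off with their
    inverses: this is a contradiction.  If x normalizes H, then x^2 is in H
    and the hypothesis provides a self-inverse representative.

    Now let G be a 2-group and let H <= G have a unique involution.  If H is not
    a perfect code, some g in N_G(H) \ H with g^2 in H has no self-inverse
    element in Hg, so <H, g> = H u Hg is strictly larger than H and still has a
    unique involution ([unique_involution_perfect_code_or_extend]).  A 2-group
    with a unique involution is cyclic or generalized quaternion.

    If G has a generalized quaternion subgroup, take a maximal one, Q: an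
    extension with a unique involution would be noncyclic, hence generalized
    quaternion, against maximality; so Q is a perfect code.  Otherwise let
    x be in G \ Phi(G).  An extension K of <x> with a unique involution is
    cyclic, so that x lies in Phi(K), hence in Phi(G), which is absurd; so <x>
    is a perfect code. *)

Set Implicit Arguments.
Unset Strict Implicit.
Unset Printing Implicit Defensive.

Local Open Scope group_scope.

(** * Counting in inverse-closed sets and transversals *)

(** Inversion pairs off the elements that are not self-inverse. *)
Lemma odd_card_self_inverse (gT : finGroupType) (A : {set gT}) :
  A^-1 = A -> odd #|A| -> exists2 s, s \in A & s^-1 = s.
Proof.
have [n] := ubnP #|A|; elim: n A => // n IHn A ltAn invA oddA.
have [s sA] : exists s, s \in A by apply/card_gt0P; case: #|A| oddA.
have [ss|neq_s] := eqVneq s^-1 s; first by exists s.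
have sVA : s^-1 \in A :\ s by rewrite !inE neq_s -mem_invg invA.
have cardA : #|A| = #|A :\ s :\ s^-1|.+2.
  by rewrite (cardsD1 s) sA (cardsD1 s^-1) sVA.
have [|||t] := IHn (A :\ s :\ s^-1).
- by move: ltAn; rewrite cardA ltnS => /ltnW.
- apply/setP=> t; rewrite mem_invg !inE -mem_invg invA.
  by rewrite (can_eq invgK) -(inj_eq invg_inj t^-1) invgK andbCA.
- by move: oddA; rewrite cardA /= negbK.
by rewrite !inE => /and3P[_ _ tA] tt; exists t.
Qed.

(** A right coset Hz meets T exactly when z is in HT; the product HT is used
    below as the union of the right cosets of H met by T. *)
Lemma mulGP (gT : finGroupType) (H : {group gT}) (T : {set gT}) (z : gT) :
  reflect (exists2 t, t \in T & z * t^-1 \in H) (z \in H * T).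
Proof.
apply: (iffP mulsgP) => [[h t hH tT ->]|[t tT ztH]].
  by exists t; rewrite // mulgK.
by exists (z * t^-1) t; rewrite // mulgKV.
Qed.

Lemma mem_mulGl (gT : finGroupType) (H : {group gT}) (T : {set gT})
    (h z : gT) : h \in H -> (h * z \in H * T) = (z \in H * T).
Proof.
move=> hH; apply/mulGP/mulGP=> -[t tT]; rewrite ?mulgA => ztH; exists t => //.
  by move: ztH; rewrite -mulgA (groupMl _ hH).
by rewrite -mulgA (groupMl _ hH).
Qed.

Lemma card_mul_rtransversal (gT : finGroupType) (H : {group gT})
    (T : {set gT}) :
  {in T &, forall s t, s * t^-1 \in H -> s = t} ->
  #|H * T| = (#|H| * #|T|)%N.
Proof.
move=> injT; have -> : H * T = [set u.1 * u.2 | u in setX H T].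
  apply/setP=> z; apply/mulsgP/imsetP=> [[h t hH tT ->]|[[h t]]].
    by exists (h, t); rewrite // inE hH.
  by rewrite inE => /andP[hH tT] ->; exists h t.
rewrite card_in_imset ?cardsX // => -[h s] [k t].
rewrite !inE /= => /andP[hH sT] /andP[kH tT] eq_hs.
suff eq_st : s = t by move: eq_hs; rewrite eq_st => /mulIg->.
apply: injT => //; suff -> : s * t^-1 = h^-1 * k by rewrite groupM ?groupV.
by apply: (mulgI h); rewrite mulgA eq_hs mulgK mulKVg.
Qed.

Lemma mulG_setIr (gT : finGroupType) (H : {group gT}) (S D : {set gT}) :
  H * D = D -> H * (S :&: D) = (H * S) :&: D.
Proof.
move=> HD; apply/eqP; rewrite eqEsubset subsetI mulgS ?subsetIl //=.
rewrite (subset_trans (mulgS _ (subsetIr _ _))) ?HD //=.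
apply/subsetP=> z /setIP[/mulGP[t tS ztH] zD]; apply/mulGP; exists t => //; rewrite inE tS -HD.
by apply/mulGP; exists z; rewrite // -groupV invMg invgK.
Qed.

(** * Double cosets *)

Section DoubleCoset.

Variables (gT : finGroupType) (H : {group gT}).
Implicit Types x y : gT.

Lemma dcosetP x y :
  reflect (exists h k, [/\ h \in H, k \in H & y = h * x * k])
          (y \in H :* x * H).
Proof.
apply: (iffP mulsgP) => [[_ k /rcosetP[h hH ->] kH ->]|[h [k [hH kH ->]]]].
  by exists h, k.
by exists (h * x) k => //; rewrite mem_rcoset mulgK.
Qed.

Lemma dcoset_refl x : x \in H :* x * H.
Proof. by apply/dcosetP; exists 1, 1; rewrite group1 mul1g mulg1. Qed.

Lemma rcoset_sub_dcoset x : H :* x \subset H :* x * H.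
Proof. exact: mulG_subl. Qed.

Lemma mulG_dcoset x : H * (H :* x * H) = H :* x * H.
Proof. by rewrite !mulgA mulGid. Qed.

Lemma invg_dcoset x : (H :* x * H)^-1 = H :* x^-1 * H.
Proof. by rewrite !invMg invg_set1 !invGid !mulgA. Qed.

Lemma dcoset_eq x y : y \in H :* x * H -> H :* y * H = H :* x * H.
Proof.
case/dcosetP=> h [k [hH kH ->]].
by rewrite !rcosetM (rcoset_id hH) -mulgA (lcoset_id kH).
Qed.

(** The number m of right cosets of H in HxH is the index of a subgroup of H,
    so it is a power of 2; if it is odd, then HxH = Hx, which forces xH = Hx. *)
Lemma odd_double_coset_norm x (m : nat) :
  2.-group H -> odd m -> #|H :* x * H| = (#|H| * m)%N -> x \in 'N(H).
Proof.
move=> pH oddm cardD.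
have defD : H :* x * H = H * (H :^ x^-1) :* x.
  by rewrite -!mulgA conjsgE invgK -!mulgA mulg_set1 mulVg mulg1.
have := mul_cardG H (H :^ x^-1)%G.
rewrite /= cardJg -(card_rcoset (H * _) x) -defD cardD -mulnA => /eqP.
rewrite eqn_pmul2l ?cardG_gt0 // => /eqP cardH.
have m1 : m = 1%N.
  have: 2.-nat m by apply: pnat_dvd pH; rewrite cardH dvdn_mulr.
  by case/p_natP=> -[|k] // def_m; move: oddm; rewrite def_m oddX.
rewrite -groupV; apply/normP/eqP; rewrite eq_sym eqEcard cardJg leqnn andbT.
apply/setIidPl/eqP; rewrite eqEcard subsetIl /= {1}cardH m1 mul1n.
exact: leqnn.
Qed.

End DoubleCoset.

(** * Maximal partial connection sets *)

(** The clause on self-inverse elements prevents a bad greedy choice: without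
    it, an involution of S outside 'N(H) could leave an odd number of cosets of
    its double coset, the last of which cannot be paired. *)
Definition partial_connection (gT : finGroupType) (G H : {group gT})
    (S : {set gT}) : bool :=
  [&& S \subset G :\: H, S^-1 == S,
      [forall s in S, forall t in S, (s * t^-1 \in H) ==> (s == t)]
    & [forall s in S, (s^-1 == s) ==> (s \in 'N(H))]].

Lemma partial_connectionP (gT : finGroupType) (G H : {group gT})
    (S : {set gT}) :
  reflect [/\ S \subset G :\: H, S^-1 = S,
              {in S &, forall s t, s * t^-1 \in H -> s = t}
            & {in S, forall s, s^-1 = s -> s \in 'N(H)}]
          (partial_connection G H S).
Proof.
apply: (iffP and4P) => [[sSG /eqP invS /forall_inP injS /forall_inP normS]|].
  split=> // [s t sS tS stH | s sS /eqP ss].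
    by have /forall_inP/(_ t tS)/implyP/(_ stH)/eqP := injS s sS.
  exact: implyP (normS s sS) ss.
case=> sSG /eqP invS injS normS; split=> //.
  apply/forall_inP=> s sS; apply/forall_inP=> t tS.
  by apply/implyP=> /(injS s t sS tS)->.
by apply/forall_inP=> s sS; apply/implyP=> /eqP; apply: normS.
Qed.

Lemma partial_connectionU (gT : finGroupType) (G H : {group gT})
    (S : {set gT}) (s : gT) :
  partial_connection G H S -> s \in G :\: H ->
  s \notin H * S -> s^-1 \notin H * S ->
  s * s \notin H \/ (s^-1 = s /\ s \in 'N(H)) ->
  partial_connection G H (s |: (s^-1 |: S)).
Proof.
move=> /partial_connectionP[sSG invS injS normS] sGH sHS sVHS self_s.
have invSP t : (t^-1 \in S) = (t \in S) by rewrite -mem_invg invS.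
have eqH a b : (a * b^-1 \in H) = (b * a^-1 \in H).
  by rewrite -groupV invMg invgK.
have apart a b : a \notin H * S -> b \in S -> a * b^-1 \in H = false.
  by move=> aHS bS; apply/negP=> abH; case/mulGP: aHS; exists b.
have ss_s : s * s \in H -> s^-1 = s.
  by case: self_s => [/negPf-> // | []].
apply/partial_connectionP; split.
- move: sGH; rewrite !subUset !sub1set !inE !groupV => ->.
  by rewrite sSG.
- apply/setP=> t; rewrite mem_invg !inE invSP (can_eq invgK) orbCA.
  by rewrite -(inj_eq invg_inj t^-1) invgK.
- move=> a b; rewrite !inE.
  case/or3P=> [/eqP->|/eqP->|aS] /or3P[/eqP->|/eqP->|bS] //; last first.
  + exact: injS.
  + by rewrite eqH apart.
  + by rewrite eqH apart.
  + by rewrite apart.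
  + by rewrite -invMg groupV => /ss_s.
  + by rewrite apart.
  + by rewrite invgK => /ss_s.
move=> a; rewrite !in_setU1 => /or3P[/eqP->|/eqP->|aS]; last exact: normS aS.
  by move=> ss; case: self_s => [|[]] //; rewrite -{1}ss mulVg group1.
rewrite invgK groupV => ss.
by case: self_s => [|[]] //; rewrite {2}ss mulgV group1.
Qed.

Section MaximalConnection.

Variables (gT : finGroupType) (G H : {group gT}) (S : {set gT}).
Hypothesis maxS : maxset (partial_connection G H) S.

(** Otherwise s and s^-1 could be added to S: they either represent two distinct
    cosets or are one element of 'N(H). *)
Lemma max_connection_unmet s :
  s \in G :\: H -> s \notin H * S -> s^-1 \notin H * S ->
  s * s \in H /\ ~ (s^-1 = s /\ s \in 'N(H)).
Proof.
move=> sGH sHS sVHS; have [pcS max] := maxsetP maxS.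
have contra_s : ~ (s * s \notin H \/ (s^-1 = s /\ s \in 'N(H))).
  move/(partial_connectionU pcS sGH sHS sVHS)/max.
  rewrite setUA subsetUr => /(_ isT) defS.
  have sS : s \in S by rewrite -defS !inE eqxx.
  by case/negP: sHS; apply/mulGP; exists s; rewrite ?mulgV.
by split=> [|ss]; [apply/negPn/negP=> ssH|]; apply: contra_s; [left | right].
Qed.

(** If Hx and Hy lie in mutually inverse double cosets, some s in Hx has its
    inverse in Hy; two distinct missed cosets of this kind would both be
    represented by adding s and s^-1. *)
Lemma max_connection_unmet_pair x y :
  x \in G :\: H -> H \subset G -> x \notin H * S -> y \notin H * S ->
  y^-1 \in H :* x * H -> y \in H :* x.
Proof.
move=> /setDP[xG xH] sHG xHS yHS /dcosetP[h [k [hH kH def_yV]]].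
have def_s : h * x = (k * y)^-1 by rewrite invMg def_yV mulgK.
have [|||ssH _] := @max_connection_unmet (h * x).
- by rewrite !inE groupMl // xH groupM // (subsetP sHG).
- by rewrite mem_mulGl.
- by rewrite def_s invgK mem_mulGl.
move: ssH; rewrite {2}def_s invMg mulgA groupMr ?groupV //.
by rewrite -mulgA groupMl // -groupV invMg invgK mem_rcoset.
Qed.

(** S represents as many cosets in D as in D^-1, because S :&: D^-1 is the set of
    inverses of S :&: D. *)
Lemma card_mul_connection_dcosetV x :
  #|(H * S) :&: (H :* x * H)^-1| = #|(H * S) :&: (H :* x * H)|.
Proof.
have [/partial_connectionP[_ invS injS _] _] := maxsetP maxS.
have injI E : {in S :&: E &, forall s t, s * t^-1 \in H -> s = t}.
  by move=> s t /setIP[sS _] /setIP[tS _]; apply: injS.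
rewrite -!mulG_setIr ?invg_dcoset ?mulG_dcoset //.
rewrite !card_mul_rtransversal -?invg_dcoset //.
by rewrite -{1}invS -invIg card_invg.
Qed.

(** If D = HxH differs from D^-1, then no coset in D^-1 can be missed, by
    [max_connection_unmet_pair]; by equality of the counts none is missed in D
    either, although Hx is. *)
Lemma max_connection_unmet_dcosetV x :
  x \in G :\: H -> H \subset G -> x \notin H * S -> x^-1 \in H :* x * H.
Proof.
move=> xGH sHG xHS; apply/contraT=> xVD.
have sDV : (H :* x * H)^-1 \subset H * S.
  apply/subsetP=> y; rewrite mem_invg => yVD; apply/contraT=> yHS.
  have yx := max_connection_unmet_pair xGH sHG xHS yHS yVD.
  case/negP: xVD.
  have yD := subsetP (rcoset_sub_dcoset H x) y yx.
  rewrite -(dcoset_eq yVD) -invg_dcoset (dcoset_eq yD).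
  by rewrite mem_invg invgK dcoset_refl.
have := proper_card (_ : (H * S) :&: (H :* x * H) \proper H :* x * H).
rewrite -card_mul_connection_dcosetV (setIidPr sDV) card_invg ltnn; apply.
rewrite properEneq subsetIr andbT; apply: contraNneq xHS => defD.
by have := dcoset_refl H x; rewrite -{1}defD => /setIP[].
Qed.

(** By the two previous arguments D = HxH equals D^-1 and has no missed coset
    other than Hx, so it consists of
    |S :&: D| + 1 right cosets.  If |S :&: D| is odd, it contains a self-inverse
    s, which normalizes H, and then so does x because x is in HsH; if it is
    even, [odd_double_coset_norm] applies. *)
Lemma max_connection_unmet_norm x :
  2.-group H -> x \in G :\: H -> H \subset G -> x \notin H * S -> x \in 'N(H).
Proof.
move=> pH xGH sHG xHS.
have xVD := max_connection_unmet_dcosetV xGH sHG xHS.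
have [/partial_connectionP[_ invS injS normS] _] := maxsetP maxS.
pose D := H :* x * H.
have invD : D^-1 = D by rewrite invg_dcoset (dcoset_eq xVD).
have [|evenI] := boolP (odd #|S :&: D|).
  case/odd_card_self_inverse=> [|s /setIP[sS sD] ss].
    by rewrite invIg invS invD.
  have sN := normS s sS ss.
  have : x \in H :* s * H by rewrite (dcoset_eq sD) dcoset_refl.
  case/dcosetP=> h [k [hH kH ->]].
  by rewrite !groupM // (subsetP (normG H)).
apply: (odd_double_coset_norm (m := #|S :&: D|.+1)) => //.
have -> : H :* x * H = (H * (S :&: D)) :|: H :* x.
  rewrite mulG_setIr ?mulG_dcoset //; apply/setP=> z; rewrite !inE.
  apply/idP/idP=> [zD|/orP[/andP[]|] //]; last first.
    exact: (subsetP (rcoset_sub_dcoset H x)).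
  rewrite zD andbT; have [//|zHS] := boolP (z \in H * S).
  apply: (max_connection_unmet_pair xGH sHG xHS zHS).
  by rewrite -mem_invg invD.
rewrite cardsU card_mul_rtransversal; last first.
  by move=> s t /setIP[sS _] /setIP[tS _]; apply: injS.
rewrite card_rcoset (_ : _ :&: (H :* x) = set0) ?cards0 ?subn0 ?mulnS 1?addnC //.
apply/setP=> z; rewrite [in RHS]inE mulG_setIr ?mulG_dcoset //.
apply/negP=> /setIP[/setIP[zHS _] /rcosetP[h hH def_z]].
by case/negP: xHS; rewrite -(mem_mulGl _ _ hH) -def_z.
Qed.

End MaximalConnection.

(** * Perfect codes from lifting involutions *)

(** The only cosets that a maximal partial connection set could miss are
    self-inverse cosets Hx with x in 'N(H), and the hypothesis supplies
    a self-inverse representative for these. *)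
Lemma group_perfect_code_of_lift (gT : finGroupType) (G H : {group gT}) :
  2.-group H -> H \subset G ->
  {in 'N_G(H) :\: H, forall g, g * g \in H ->
     exists2 s, s \in H :* g & s^-1 = s} ->
  group_perfect_code G H.
Proof.
move=> pH sHG lift.
have [S maxS] : {S | maxset (partial_connection G H) S}.
  apply: ex_maxset; exists set0; apply/partial_connectionP.
  rewrite sub0set; split=> //; try by move=> s; rewrite inE.
  by apply/setP=> s; rewrite mem_invg !inE.
have [/partial_connectionP[sSG invS injS _] _] := maxsetP maxS.
have hit x : x \in G :\: H -> x \in H * S.
  move=> xGH; apply/contraT=> xHS; have [xG xH] := setDP xGH.
  have xN := max_connection_unmet_norm maxS pH xGH sHG xHS.
  have xVD := max_connection_unmet_dcosetV maxS xGH sHG xHS.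
  have xxH : x * x \in H.
    case/dcosetP: xVD => h [k [hH kH /(canRL invgK) def_x]].
    rewrite {1}def_x !invMg -!mulgA groupMl ?groupV //.
    by rewrite -conjgE memJ_norm ?groupV.
  have [|s /rcosetP[h hH def_s] ss] := lift x _ xxH.
    by rewrite in_setD in_setI xH xG.
  have sN : s \in 'N(H) by rewrite def_s groupM // (subsetP (normG H)).
  have sHS : s \notin H * S by rewrite def_s mem_mulGl.
  have [||_ []//] := max_connection_unmet maxS _ sHS; last by rewrite ss.
  by rewrite def_s !inE groupMl // xH groupM // (subsetP sHG).
exists S.
  split=> //; apply: subset_trans sSG _; apply/subsetP=> s.
  by rewrite !inE; case: eqP => [->|_] /andP[]; rewrite ?group1.
split=> // [x y xH yH|x /setDP[xG xH]].
  by apply/negP=> /(subsetP sSG); rewrite !inE groupM ?groupV.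
(* The neighbours c of x in H correspond to the elements cx^-1 of S in
   H x^-1, so it is the coset of x^-1, not of x, that has to be met. *)
have /mulGP[s sS xsH] : x^-1 \in H * S by rewrite hit // !inE !groupV xH.
have sxH : s * x \in H by rewrite -groupV invMg.
apply/eqP/cards1P; exists (s * x); apply/setP=> c; rewrite !inE /cayley_adj.
apply/andP/eqP=> [[cH cxS]|->]; last by rewrite mulgK.
have <- : c * x^-1 = s; last by rewrite mulgKV.
by apply: injS => //; rewrite -mulgA groupMl // -invMg groupV.
Qed.

(** * Subgroups of 2-groups with a unique involution *)

Lemma Ohm1_eq_of_involutions (gT : finGroupType) (H K : {group gT}) :
  2.-group K -> H \subset K -> {in K :\: H, forall s, s^-1 != s} ->
  'Ohm_1(K) = 'Ohm_1(H).
Proof.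
move=> pK sHK noinv; apply/eqP; rewrite eqEsubset (OhmS 1 sHK) andbT.
rewrite (OhmE 1 pK) (OhmE 1 (pgroupS sHK pK)) genS //.
apply/subsetP=> s; rewrite !inE expn1 => /andP[sK /eqP s2].
rewrite s2 eqxx andbT; apply/contraT=> sH.
have /noinv/eqP[] : s \in K :\: H by rewrite !inE sH.
by apply: (mulgI s); rewrite mulgV -s2.
Qed.

(** In a cyclic 2-group <[k]> every element outside <[k ^+ 2]> = 'Phi(<[k]>) is
    an odd power of k, hence a generator. *)
Lemma cyclic_proper_sub_Phi (gT : finGroupType) (H K : {group gT}) :
  2.-group K -> cyclic K -> H \proper K -> H \subset 'Phi(K).
Proof.
move=> pK cK prHK; rewrite (Phi_Mho pK (cyclic_abelian cK)).
case/cyclicP: cK pK prHK => k -> pk.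
rewrite (Mho_p_cycle 1 pk) expn1 properE => /andP[sHk nkH].
apply/subsetP=> h hH; have /cycleP[i def_h] := subsetP sHk h hH.
have [oddi|eveni] := boolP (odd i); last first.
  rewrite def_h -(odd_double_half i) (negPf eveni) add0n -mul2n expgM.
  exact: mem_cycle.
have : generator <[k]> h.
  rewrite def_h generator_coprime.
  by apply: (pnat_coprime pk); rewrite p'natE // dvdn2 oddi.
by move/eqP=> defk; case/negP: nkH; rewrite defk cycle_subG.
Qed.

(** A generalized quaternion group of order 2^n has nilpotency class n - 1 > 1. *)
Lemma quaternion_class_noncyclic (gT : finGroupType) (Q : {group gT}) :
  extremal_class Q = Quaternion -> ~~ cyclic Q.
Proof.
case/quaternion_classP=> n n2 isoQ; apply/negP=> /cyclic_abelian.
have [[x y] genQ _] := generators_quaternion n2 isoQ.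
have [_ [_ _ _ nilQ] _ _ _] := quaternion_structure n2 genQ isoQ.
rewrite -nil_class1 nilQ => {x y genQ nilQ isoQ}.
by case: n n2 => [|[|[|n]]].
Qed.

(** For 2-groups, |'Ohm_1(H)| = 2 expresses that H has a unique involution.  The
    extension is K = <H, g> where g violates the lifting condition: K \ H = Hg
    contains no involution, so K has no more involutions than H. *)
Lemma unique_involution_perfect_code_or_extend (gT : finGroupType)
    (G H : {group gT}) :
  2.-group G -> H \subset G -> #|'Ohm_1(H)| = 2 ->
  group_perfect_code G H \/
  exists K : {group gT}, [/\ K \subset G, H \proper K & #|'Ohm_1(K)| = 2].
Proof.
move=> pG sHG oH; have pH := pgroupS sHG pG.
have [/existsP[g /and3P[gNH ggH /forall_inP noinv]]|] := boolP
  [exists g, [&& g \in 'N_G(H) :\: H, g * g \in H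
               & [forall s in H :* g, s^-1 != s]]]; last first.
  rewrite negb_exists => /forallP lift; left.
  apply: group_perfect_code_of_lift => // g gNH ggH.
  have := lift g; rewrite gNH ggH /= => /forall_inPn[s sHg].
  by rewrite negbK => /eqP; exists s.
right; have /setDP[/setIP[gG gN] gH] := gNH.
have sNg : <[g]> \subset 'N(H) by rewrite cycle_subG.
have sHK : H \subset H <*> <[g]> by apply: joing_subl.
have sKG : H <*> <[g]> \subset G by rewrite join_subG sHG cycle_subG.
exists (H <*> <[g]>)%G; split=> //.
  rewrite properE sHK; apply: contra gH => /subsetP-> //.
  by rewrite (subsetP (joing_subr H _)) ?cycle_id.
rewrite (@Ohm1_eq_of_involutions _ H) ?(pgroupS sKG) // => s.
rewrite inE /= norm_joinEr // => /andP[sH /mulsgP[h _ hH /cycleP[i ->] def_s]].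
apply: noinv; have giH : g ^+ (i./2).*2 \in H.
  by rewrite -mul2n expgM groupX // expgS expg1.
have [oddi|eveni] := boolP (odd i); last first.
  case/negP: sH.
  by rewrite def_s groupM // -(odd_double_half i) (negPf eveni) add0n.
rewrite mem_rcoset def_s -(odd_double_half i) oddi addnC expgD expg1 !mulgA.
by rewrite mulgK groupM.
Qed.

Theorem theorem5p4 (gT : finGroupType) (G : {group gT}) (pG : 2.-group G) :
  (forall x : gT, x \in G :\: 'Phi(G) -> group_perfect_code G <[x]>) \/
  (exists Q : {group gT},
     [/\ Q \subset G, generalized_quaternion Q & group_perfect_code G Q]).
Proof.
have quaternion_of_Ohm1 (K : {group gT}) : K \subset G -> #|'Ohm_1(K)| = 2 ->
    ~~ cyclic K -> extremal_class K == Quaternion.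
  move=> sKG oK ncK; have pK := pgroupS sKG pG.
  have ntK : K :!=: 1.
    by apply: contraNneq ncK => ->; apply: cyclic1.
  by move/(prime_Ohm1P pK ntK): oK; rewrite (negPf ncK).
pose quatG (K : {group gT}) :=
  (K \subset G) && (extremal_class K == Quaternion).
have [/existsP[Q0 quatQ0]|noQ] := boolP [exists Q, quatG Q].
  right; have [Q maxQ] : {Q : {group gT} | maxgroup Q quatG}.
    by apply: ex_maxgroup; exists Q0.
  have [/andP[sQG qQ] max] := maxgroupP maxQ.
  have pQ := pgroupS sQG pG.
  have [n n2 isoQ] := (quaternion_classP Q).1 (eqP qQ).
  exists Q; split=> //; first by exists n.
  have ncQ := quaternion_class_noncyclic (eqP qQ).
  have ntQ : Q :!=: 1 by apply: contraNneq ncQ => ->; apply: cyclic1.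
  have oQ : #|'Ohm_1(Q)| = 2 by apply/(prime_Ohm1P pQ ntQ); rewrite qQ orbT.
  have [//|[K [sKG prQK oK]]] :=
    unique_involution_perfect_code_or_extend pG sQG oQ.
  have ncK : ~~ cyclic K.
    by apply: contra ncQ; apply/cyclicS/proper_sub.
  have := proper_card prQK.
  rewrite (max K _ (proper_sub prQK)) ?ltnn //.
  by rewrite /quatG sKG quaternion_of_Ohm1.
left=> x /setDP[xG xPhi].
have sxG : <[x]> \subset G by rewrite cycle_subG.
have ox : #|'Ohm_1(<[x]>)| = 2.
  apply: Ohm1_cyclic_pgroup_prime (cycle_cyclic x) (pgroupS sxG pG) _.
  by rewrite cycle_eq1; apply: contraNneq xPhi => ->.
have [//|[K [sKG prxK oK]]] :=
  unique_involution_perfect_code_or_extend (H := <[x]>%G) pG sxG ox.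
have [cK|ncK] := boolP (cyclic K).
  case/negP: xPhi; rewrite -cycle_subG.
  apply: subset_trans (PhiS pG sKG).
  exact: cyclic_proper_sub_Phi (pgroupS sKG pG) cK prxK.
case/existsP: noQ; exists K.
by rewrite /quatG sKG quaternion_of_Ohm1.
Qed.
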